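(* Let $G$ be a finite simple graph and $X_0,X_1,\dots,X_{k+1}$ a nice path decomposition of $G$ of width $w$. Let $S$ and $\mathcal F$ be the zero forcing set and fort packing returned by the Zero Forcing Set Algorithm (described in the context) on input $G$ and this decomposition. Then $|S|\le(w+1)|\mathcal F|$.
   Context: A fort of $G=(V,E)$ is a set $F\subseteq V$ such that no vertex of $V\setminus F$ has exactly one neighbour in $F$. Zero forcing: a blue vertex $u$ may force a white neighbour $v$ if $v$ is the only white vertex in $N[u]$. An arc set of a graph $H=(U,F)$ is a set of ordered pairs $(u,v)$ with $uv\in F$, not containing both $(u,v)$ and $(v,u)$; it is a forcing arc set if it is a collection of vertex-disjoint directed paths and there is a zero forcing process on $H$ starting from its sources (in-degree zero vertices), each white vertex forced by exactly one vertex and all vertices ending blue, such that $(u,v)$ is an arc exactly when $u$ forces $v$. $\overleftarrow{A}=\{(v,u):(u,v)\in A\}$. A nice path decomposition of $G$ is a sequence $X_0,\dots,X_{k+1}\subseteq V$ with (D1) every edge contained in some $X_i$, $1\le i\le k$; (D2) if $v\in X_i\cap X_j$, $i<j$, then $v\in X_s$ for $i\le s\le j$; (D3) $X_0=X_{k+1}=\emptyset$, other $X_i$ nonempty; (D4) consecutive sets differ by adding or deleting exactly one vertex; and every vertex of $G$ lies in some $X_i$. Its width is $\max\{|X_i|-1:1\le i\le k\}$. Notation: $X_i^j=\bigcup_{\tau=i}^jX_\tau$, $G(i,j)=G[X_i^j]$; $\mathsf{White}(S,H)$ is the set of vertices of $H$ still white when the zero forcing process on $H$ from initial blue set $S$ can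 no longer force; $\mathsf{FAS}(S,H)$ is a fixed canonically chosen forcing arc set representing the zero forcing process on $H$ from $S$; $\mathsf{Sources}(A,U)$ is the set of vertices of $U$ of in-degree zero in $(U,A)$. The Zero Forcing Set Algorithm: (L1) $t\leftarrow0$, $S\leftarrow\emptyset$, $A\leftarrow\emptyset$, $\mathcal F\leftarrow\emptyset$. (L2) $z\leftarrow t$, $W\leftarrow\emptyset$. (L3) while $W=\emptyset$ and $z\le k$: $z\leftarrow z+1$, $W\leftarrow\mathsf{White}(X_t\cup X_z,G(t,z))$. (L4) $A\leftarrow\overleftarrow{A}$. (L5) $S\leftarrow\mathsf{Sources}(A,X_0^t)$. (L6) if $W\ne\emptyset$: add $W$ to $\mathcal F$; $S\leftarrow S\cup X_{z-1}$; $A'\leftarrow A\cup\mathsf{FAS}(X_t\cup X_{z-1},G(t,z))$; $A\leftarrow\{(u,v)\in A':v\notin X_z\}$; $t\leftarrow z$; go to (L2). (L7) if $W=\emptyset$: $A\leftarrow A\cup\mathsf{FAS}(X_t,G(t,z))$. (L8) return $S$ and $\mathcal F$. *)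

(* Defs.v *)
From mathcomp Require Import all_boot.

Set Implicit Arguments.
Unset Strict Implicit.
Unset Printing Implicit Defensive.

(* A finite simple graph G is a symmetric irreflexive relation e on a finType
   V.  Every graph H on which zero forcing is run is an induced subgraph G[U]
   of G, and is represented by its vertex set U : {set V}. *)

Section ZeroForcing.

Variables (V : finType) (e : rel V).
Implicit Types (U B S : {set V}) (A : {set V * V}) (s : seq (V * V)).

Definition closed_nbhd U (u : V) : {set V} :=
  [set x in U | (x == u) || e u x].

(* In G[U] with blue set B, the vertex u may force the vertex v. *)
Definition can_force U B (u v : V) : bool :=
  [&& u \in U, u \in B, v \in U :\: B, e u v
    & closed_nbhd U u :\: B == [set v]].

(* s is the chronological list of forces (u, v), "u forces v". *)
Fixpoint zf_process U B s : bool :=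
  if s is a :: s' then
    can_force U B a.1 a.2 && zf_process U (a.2 |: B) s'
  else true.

Definition blue_after S s : {set V} := S :|: [set v in unzip2 s].

Definition zf_round U B : {set V} :=
  B :|: [set v | [exists u, can_force U B u v]].

(* #|V| rounds suffice to reach the blue set at which no force is possible;
   see white_process below. *)
Definition White S U : {set V} := U :\: iter #|V| (zf_round U) S.

Definition Sources A U : {set V} :=
  [set v in U | [forall u in U, (u, v) \notin A]].

Definition arc_rev A : {set V * V} := [set (a.2, a.1) | a in A].

Definition arc_set U A : Prop :=
  (forall u v, (u, v) \in A -> [&& u \in U, v \in U & e u v])
  /\ (forall u v, ~ ((u, v) \in A /\ (v, u) \in A)).

(* Each path is the list of its successive vertices. *)
Definition disjoint_paths A : Prop :=
  exists P : seq (seq V),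
    uniq (flatten P)
    /\ forall u v, (u, v) \in A <-> exists2 p, p \in P & infix [:: u; v] p.

Definition forcing_arc_set U A : Prop :=
  [/\ arc_set U A, disjoint_paths A
    & exists s, [/\ zf_process U (Sources A U) s,
                    blue_after (Sources A U) s = U
                  & forall u v, (u, v) \in A <-> (u, v) \in s]].

(* fas S U is a choice of forcing arc set representing the process on G[U]
   started at S.  Such an arc set exists only if that process turns all of U
   blue, so fas is left arbitrary on other arguments; the algorithm never
   evaluates it there. *)
Definition FAS_spec (fas : {set V} -> {set V} -> {set V * V}) : Prop :=
  forall S U, S \subset U -> White S U = set0 ->
    forcing_arc_set U (fas S U) /\ Sources (fas S U) U = S.

End ZeroForcing.

Section PathDecomposition.

Variables (V : finType) (e : rel V) (k : nat) (X : nat -> {set V}).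

(* The decomposition is X 0, ..., X k.+1; the values of X beyond k.+1 are
   irrelevant. *)
Definition nice_path_decomposition : Prop :=
  [/\ forall u v, e u v ->
        exists i, [&& 1 <= i, i <= k, u \in X i & v \in X i],
      forall v i j s, i < j -> j <= k.+1 -> v \in X i -> v \in X j ->
        i <= s <= j -> v \in X s,
      [/\ X 0 = set0, X k.+1 = set0
        & forall i, 1 <= i <= k -> X i != set0],
      forall i, i <= k -> exists v,
        (v \notin X i /\ X i.+1 = v |: X i)
        \/ (v \in X i /\ X i.+1 = X i :\ v)
    & forall v, exists2 i, i <= k.+1 & v \in X i].

Definition pd_width : nat := \max_(1 <= i < k.+1) (#|X i| - 1).

Definition bags (i j : nat) : {set V} := \bigcup_(i <= tau < j.+1) X tau.

End PathDecomposition.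

Section Algorithm.

Variables (V : finType) (e : rel V) (k : nat) (X : nat -> {set V}).
Variable fas : {set V} -> {set V} -> {set V * V}.

(* The inner while loop, entered with W empty.  The invariant n = k+1-z
   makes the loop condition z <= k read n > 0. *)
Fixpoint scan (n t z : nat) : nat * {set V} :=
  if n is n'.+1 then
    let W := White e (X t :|: X z.+1) (bags X t z.+1) in
    if W == set0 then scan n' t z.+1 else (z.+1, W)
  else (z, set0).

Record state := State {
  st_t : nat;
  st_S : {set V};
  st_A : {set V * V};
  st_F : {set {set V}} }.

Definition zfs_init : state := State 0 set0 set0 set0.

(* One pass of the outer loop; the boolean says whether to loop again. *)
Definition zfs_pass (st : state) : state * bool :=
  let: State t _ A F := st in
  let: (z, W) := scan (k.+1 - t) t t in
  let A := arc_rev A in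
  let S := Sources A (bags X 0 t) in
  if W != set0 then
    let S := S :|: X z.-1 in
    let A' := A :|: fas (X t :|: X z.-1) (bags X t z) in
    let A := [set a in A' | a.2 \notin X z] in
    (State z S A (W |: F), true)
  else
    let A := A :|: fas (X t) (bags X t z) in
    (State t S A F, false).

Inductive zfs_run : state -> state -> Prop :=
| zfs_run_stop st st' : zfs_pass st = (st', false) -> zfs_run st st'
| zfs_run_next st st' st'' :
    zfs_pass st = (st', true) -> zfs_run st' st'' -> zfs_run st st''.

Definition zfs_returns (S : {set V}) (F : {set {set V}}) : Prop :=
  exists2 st, zfs_run zfs_init st & (st_S st = S /\ st_F st = F).

End Algorithm.

(* White is the outcome of every exhausted process (white_process), a choice
   satisfying FAS_spec exists (FAS_exists), and the algorithm returns exactly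
   one output (zfs_returns_exists, zfs_returns_unique). *)

Section SanityChecks.

Variables (V : finType) (e : rel V).
Implicit Types (U B C S : {set V}) (s : seq (V * V)).

Lemma can_force_sub U B C u v :
  B \subset C -> can_force e U B u v -> v \notin C -> can_force e U C u v.
Proof.
move=> sBC /and5P[uU uB]; rewrite inE => /andP[_ vU] euv /eqP Nu vC.
rewrite /can_force uU (subsetP sBC) //= inE vC vU euv /=.
rewrite eqEsubset -{1}Nu setDS //= sub1set !inE vC vU euv orbT //.
Qed.

Lemma zf_round_sub U B C :
  B \subset C -> zf_round e U B \subset zf_round e U C.
Proof.
move=> sBC; apply/subsetP => v; rewrite !inE.
have [//|vC] := boolP (v \in C).
case/orP => [vB|/existsP[u fuv]]; first by rewrite (subsetP sBC) in vC.
by apply/existsP; exists u; apply: can_force_sub fuv vC.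
Qed.

Lemma iter_zf_round_inflate U S n m :
  n <= m -> iter n (zf_round e U) S \subset iter m (zf_round e U) S.
Proof.
move=> /subnK <-; elim: (m - n) => //= d IH.
exact: subset_trans IH (subsetUl _ _).
Qed.

Lemma zf_round_stable U S :
  zf_round e U (iter #|V| (zf_round e U) S) = iter #|V| (zf_round e U) S.
Proof.
pose F n := iter n (zf_round e U) S.
have stab n : F n.+1 = F n -> forall m, n <= m -> F m = F n.
  by move=> h m /subnK <-; elim: (m - n) => //= d ->.
suff [n le_n h] : exists2 n, n <= #|V| & F n.+1 = F n.
  exact: etrans (stab n h _ (leqW le_n)) (esym (stab n h _ le_n)).
have [/existsP[n /eqP h]|] :=
  boolP [exists n : 'I_#|V|.+1, F n.+1 == F n].
  by exists n => //; rewrite -ltnS.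
rewrite negb_exists => /forallP neF.
suff /(_ #|V|.+1 (leqnn _)) : forall n, n <= #|V|.+1 -> n <= #|F n|.
  by move=> /leq_trans/(_ (max_card _)); rewrite ltnn.
elim=> // n IH lt_n; apply: leq_ltn_trans (IH (ltnW lt_n)) _.
apply: proper_card; rewrite properEneq eq_sym (neF (Ordinal lt_n)) /=.
exact: (iter_zf_round_inflate U S (leqnSn n)).
Qed.

Lemma white_process U S s :
  zf_process e U S s ->
  (forall u v, ~~ can_force e U (blue_after S s) u v) ->
  White e S U = U :\: blue_after S s.
Proof.
move=> Ps stop; congr (_ :\: _); apply/eqP; rewrite eqEsubset; apply/andP; split.
  have sSB : S \subset blue_after S s by apply: subsetUl.
  elim: #|V| => //= n /(zf_round_sub U)/subset_trans; apply.
  apply/subsetP => v; rewrite in_setU inE => /orP[//|/existsP[u]].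
  by rewrite (negPf (stop u v)).
have: S \subset iter #|V| (zf_round e U) S.
  exact: (iter_zf_round_inflate U S (leq0n _)).
move: (zf_round_stable U S); set C := iter _ _ _; move: C => C CC.
rewrite /blue_after subUset => sSC; rewrite sSC /=.
elim: s S Ps sSC {stop} => [|[u v] s IH] S /=.
  by move=> _ _; apply/subsetP => x; rewrite !inE.
case/andP => fuv Ps sSC.
have vC : v \in C.
  apply: contraT => vC; rewrite -(negPf vC) -CC !inE; apply/orP; right.
  by apply/existsP; exists u; apply: can_force_sub fuv vC.
have := IH _ Ps; rewrite subUset sub1set vC => /(_ sSC) /subsetP sC.
apply/subsetP => x; rewrite !inE => /predU1P[->//|xs].
by apply: sC; rewrite inE.
Qed.

Lemma zf_process_rcons U S s u v :
  zf_process e U S (rcons s (u, v)) =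
  zf_process e U S s && can_force e U (blue_after S s) u v.
Proof.
elim: s S => [|[a b] s IH] S /=.
  by rewrite andbT; congr can_force; apply/setP=> x; rewrite !inE orbF.
rewrite IH andbA; congr (_ && can_force _ _ _ _ _).
by apply/setP=> x; rewrite !inE orbCA orbA.
Qed.

Lemma zf_process_exhaust U S :
  exists2 s, zf_process e U S s
    & forall u v, ~~ can_force e U (blue_after S s) u v.
Proof.
suff: forall s, zf_process e U S s -> exists2 s', zf_process e U S s'
    & forall u v, ~~ can_force e U (blue_after S s') u v by move=> /(_ [::]); apply.
move=> s; have [n] := ubnP #|U :\: blue_after S s|.
elim: n s => // n IH s; rewrite ltnS => le_n Ps.
have [/existsP[u /existsP[v fuv]]|] :=
  boolP [exists u, exists v, can_force e U (blue_after S s) u v].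
  apply: (IH (rcons s (u, v))); last by rewrite zf_process_rcons Ps.
  apply: leq_trans le_n; apply: proper_card; apply/properP; split.
    apply: setDS; apply: setUS; apply/subsetP=> x.
    by rewrite !inE /unzip2 map_rcons mem_rcons inE orbC => ->.
  case/and5P: fuv => _ _ vUB _ _; exists v => //.
  by rewrite !inE /unzip2 map_rcons mem_rcons inE eqxx orbT.
rewrite negb_exists => /forallP h; exists s => // u v.
by move: (h u); rewrite negb_exists => /forallP.
Qed.

Lemma infix2_rcons (p : seq V) u v a b :
  infix [:: a; b] (rcons (rcons p u) v) =
  ((a, b) == (u, v)) || infix [:: a; b] (rcons p u).
Proof.
rewrite infix_rconsl -[[:: a; b]]/(rcons (rcons [::] a) b) !suffix_rcons.
by rewrite suffix0s andbT xpair_eqE andbC.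
Qed.

Lemma blue_after_rcons S s u v :
  blue_after S (rcons s (u, v)) = v |: blue_after S s.
Proof.
by apply/setP=> x; rewrite !inE /unzip2 map_rcons mem_rcons inE orbCA.
Qed.

Lemma process_paths U S s : zf_process e U S s ->
  exists P : seq (seq V), [/\ uniq (flatten P), flatten P =i blue_after S s,
    forall a b, (a, b) \in s <-> exists2 p, p \in P & infix [:: a; b] p
  & forall x y, x \in U -> x \in blue_after S s -> e x y ->
      y \in U :\: blue_after S s -> exists p, rcons p x \in P].
Proof.
elim/last_ind: s => [|s [u v] IH].
  move=> _; exists [seq [:: x] | x <- enum S].
  have fE : flatten [seq [:: x] | x <- enum S] = enum S by apply: flatten_seq1.
  rewrite fE enum_uniq; split=> //.
  - by move=> x; rewrite mem_enum !inE orbF.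
  - by move=> a b; split=> // -[p /mapP[x _ ->]]; rewrite infixs1 /= eqseq_cons andbF.
  - move=> x y _; rewrite !inE orbF => xS _ _; exists [::].
    by apply/mapP; exists x; rewrite ?mem_enum.
rewrite zf_process_rcons => /andP[/IH[P [uP fP aP lP]] fuv].
rewrite blue_after_rcons; set B := blue_after S s in fP lP fuv *.
case/and5P: (fuv) => uU uB vUB euv /eqP Nu.
have [p0 p0P] := lP u v uU uB euv vUB.
have permP := perm_to_rem p0P; set P' := rem _ P in permP.
have permF : perm_eq (flatten P) (rcons p0 u ++ flatten P').
  by rewrite (perm_flatten permP).
have vB : v \notin B by move: vUB; rewrite inE => /andP[].
exists (rcons (rcons p0 u) v :: P'); rewrite /=.
have permF' : perm_eq (rcons (rcons p0 u) v ++ flatten P') (v :: flatten P).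
  by rewrite cat_rcons perm_catC /= perm_cons perm_catC perm_sym.
split.
- by rewrite (perm_uniq permF') /= fP vB.
- by move=> x; rewrite (perm_mem permF') !inE fP !inE.
- move=> a b; rewrite mem_rcons inE; split.
    case/predU1P=> [abE|/aP[p]].
      by exists (rcons (rcons p0 u) v); rewrite ?mem_head // infix2_rcons abE eqxx.
    rewrite (perm_mem permP) inE => /predU1P[->|pP'] iab.
      by exists (rcons (rcons p0 u) v); rewrite ?mem_head // infix2_rcons iab orbT.
    by exists p; rewrite // inE pP' orbT.
  case=> p; rewrite inE => /predU1P[->|pP'].
    rewrite infix2_rcons => /orP[->//|iab]; apply/orP; right; apply/aP.
    by exists (rcons p0 u).
  move=> iab; apply/orP; right; apply/aP; exists p => //.
  by rewrite (perm_mem permP) inE pP' orbT.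
- move=> x y xU; rewrite in_setU1 => /predU1P[-> _ _|xB exy yU].
    by exists (rcons p0 u); rewrite mem_head.
  move: yU; rewrite in_setD in_setU1 negb_or -andbA => /and3P[yv yB yU].
  have yUB : y \in U :\: B by rewrite in_setD yB.
  have [p pP] := lP x y xU xB exy yUB.
  exists p; rewrite inE; apply/orP; right.
  move: pP; rewrite (perm_mem permP) inE => /predU1P[/rcons_inj[_ xu]|//].
  have : y \in closed_nbhd e U u :\: B by rewrite in_setD yB inE yU -xu exy orbT.
  by rewrite Nu inE (negPf yv).
Qed.

Lemma process_arc U S s a b : zf_process e U S s -> (a, b) \in s ->
  [/\ a \in U, b \in U, e a b & b \notin S].
Proof.
elim: s S => // -[c d] s IH S /= /andP[fcd Ps]; rewrite inE => /predU1P[[-> ->]|].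
  by case/and5P: fcd => -> _; rewrite inE => /andP[-> ->] ->.
by case/(IH _ Ps) => -> -> ->; rewrite !inE negb_or => /andP[].
Qed.

Lemma process_noloop U S s a b : zf_process e U S s ->
  (a, b) \in s -> (b, a) \in s -> False.
Proof.
elim: s S => // -[c d] s IH S /= /andP[fcd Ps].
have cS : c \in d |: S by case/and5P: fcd => _ cS _ _ _; rewrite inE cS orbT.
have dS : d \notin S by case/and5P: fcd => _ _; rewrite inE => /andP[].
have cS' : c \in S by case/and5P: fcd.
rewrite !inE => /predU1P[[-> ->]|ab] /predU1P[[ba]|ba].
- by rewrite ba cS' in dS.
- by case: (process_arc Ps ba); rewrite cS.
- by move=> ac; case: (process_arc Ps ab); rewrite ba cS.
- exact: IH Ps ab ba.
Qed.

Lemma FAS_exists : exists fas, FAS_spec e fas.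
Proof.
suff H S U : exists A, S \subset U -> White e S U = set0 ->
    forcing_arc_set e U A /\ Sources A U = S.
  have /fin_all_exists[f fP] (x : {set V} * {set V}) := H x.1 x.2.
  by exists (fun S U => f (S, U)) => S U; apply: (fP (S, U)).
have [s Ps stop] := zf_process_exhaust U S.
exists [set a in s] => sSU; rewrite (white_process Ps stop) => /eqP.
rewrite setD_eq0 => sUB.
have SE : Sources [set a in s] U = S.
  apply/setP=> x; rewrite !inE; apply/andP/idP=> [[xU /forall_inP h]|xS].
    move/(subsetP sUB): xU; rewrite !inE => /orP[//|/mapP[[a b] ab /= xb]].
    have [aU _ _ _] := process_arc Ps ab.
    by move: (h a aU); rewrite inE xb ab.
  split; first exact: (subsetP sSU).
  by apply/forall_inP=> u uU; rewrite inE; apply/negP=> /(process_arc Ps)[_ _ _]; rewrite xS.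
split=> //; split.
- split=> [u v|u v []]; rewrite !inE => uv; first by have [-> -> ->] := process_arc Ps uv.
  exact: process_noloop Ps uv.
- have [P [uP _ aP _]] := process_paths Ps; exists P; split=> // u v.
  by rewrite inE; apply: aP.
exists s; rewrite SE; split=> //; last by move=> u v; rewrite inE.
apply/eqP; rewrite eqEsubset sUB andbT subUset sSU; apply/subsetP=> x.
by rewrite inE => /mapP[[a b] ab ->]; have [] := process_arc Ps ab.
Qed.

Variables (k : nat) (X : nat -> {set V}).
Variable fas : {set V} -> {set V} -> {set V * V}.

Lemma scan_bound n t z :
  let: (z', W) := scan e X n t z in
  z' <= n + z /\ (W != set0 -> z < z').
Proof.
elim: n z => [|n IH] z /=; first by rewrite eqxx.
case: ifPn => W0; last by rewrite addSn ltnS leq_addl.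
by move: (IH z.+1); case: scan => z' W [le1 lt2]; rewrite addSnnS; split=> // /lt2/ltnW.
Qed.

Lemma zfs_run_exists st :
  st_t st <= k.+1 -> exists st', zfs_run e k X fas st st'.
Proof.
have [n] := ubnP (k.+1 - st_t st); elim: n st => // n IH [t S A F] /=.
rewrite ltnS => le_n le_t.
have := erefl (zfs_pass e k X fas (State t S A F)); rewrite {1}/zfs_pass.
case E: scan (scan_bound (k.+1 - t) t t) => [z W] [le_z lt_z].
rewrite subnK // in le_z; case: ifPn => W0 /esym pass; last first.
  by eexists; apply: zfs_run_stop pass.
have lt_tz := lt_z W0; set st1 := State z _ _ _ in pass.
have [|//|st' run] := IH st1; last by exists st'; apply: zfs_run_next pass run.
by apply: leq_trans le_n; apply: ltn_sub2l => //; apply: leq_trans lt_tz le_z.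
Qed.

Lemma zfs_returns_exists : exists S F, zfs_returns e k X fas S F.
Proof.
have [st' run] : exists st', zfs_run e k X fas (zfs_init V) st'.
  exact: zfs_run_exists.
by exists (st_S st'), (st_F st'), st'.
Qed.

Lemma zfs_returns_unique S F S' F' :
  zfs_returns e k X fas S F -> zfs_returns e k X fas S' F' -> S = S' /\ F = F'.
Proof.
case=> st1 run1 [<- <-] [st2 run2 [<- <-]].
suff ->: st1 = st2 by [].
elim: run1 st2 run2 => {st1} [st st1 p1|st st1 st1' p1 _ IH] st2 run2.
  by case: run2 p1 => {st st2} [st st2|st st2 st2'] -> // [].
by case: run2 p1 => {st st2} [st st2|st st2 st2'] -> // + [eq2]; rewrite eq2 => /IH.
Qed.

End SanityChecks.

(* Main.v *)
Require Import Defs.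
From mathcomp Require Import all_boot.

Set Implicit Arguments.
Unset Strict Implicit.
Unset Printing Implicit Defensive.

(** The number of sources of a family of disjoint paths on [U] is [|U|] minus
the number of arcs, so it is unchanged by reversal.  Hence each pass adding a
fort [W] creates at most [|X_{z-1} :|: X_z|] new sources.  A pass can only find
its fort at a step [z] deleting a vertex, since adding a blue vertex preserves
complete forcing; so [X_{z-1} :|: X_z = X_{z-1}] has at most [w + 1] vertices.
The fort found is new because it avoids [X_t], which separates the vertices
seen up to [t] from those seen after [t]. *)

(** * Arcs, sources and paths *)

Lemma in_arc_rev (V : finType) (A : {set V * V}) u v :
  ((u, v) \in arc_rev A) = ((v, u) \in A).
Proof.
apply/imsetP/idP=> [[[a b] ab /= [-> ->]] //|vu].
by exists (v, u).
Qed.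

(** Sources are the vertices of [U] that are not heads, and injectivity of [snd] makes heads as
    numerous as arcs. *)
Lemma card_Sources (V : finType) (A : {set V * V}) (U : {set V}) :
  (forall a, a \in A -> (a.1 \in U) && (a.2 \in U)) ->
  {in A &, injective snd} -> #|Sources A U| + #|A| = #|U|.
Proof.
move=> AU injA; rewrite -(card_in_imset injA).
have -> : Sources A U = U :\: snd @: A.
  apply/setP=> x; rewrite !inE andbC; congr (_ && _).
  apply/forall_inP/negP=> [noA /imsetP[[a b] ab /= xb]|noA u uU].
    by have /andP[aU _] := AU _ ab; have := noA a aU; rewrite xb ab.
  by apply/negP=> ux; apply: noA; apply/imsetP; exists (u, x).
rewrite addnC -[RHS](cardsID (snd @: A)); congr (_ + _); apply: eq_card => x.
rewrite inE andb_idl // => /imsetP[a aA ->].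
by have /andP[] := AU a aA.
Qed.

Lemma infix2_nth (T : eqType) (q : seq T) (u v d : T) :
  uniq q -> infix [:: u; v] q ->
  v = nth d q (index u q).+1 /\ u = nth d q (index v q).-1.
Proof.
move=> + /infixP[p [s def_q]]; rewrite {q}def_q cat_uniq /= negb_or negb_or.
case/and3P=> _ /and3P[up vp _]; rewrite inE negb_or => /andP[/andP[uv _] _].
rewrite !index_cat (negPf up) (negPf vp) /= eqxx (negPf uv) eqxx.
by rewrite !nth_cat addn0 addn1 /= !ltnn ltnNge leqnSn subSnn subnn.
Qed.

(** Every arc joins consecutive entries of the duplicate-free sequence [flatten P], where a position
    determines its successor and its predecessor. *)
Lemma disjoint_paths_inj (V : finType) (A : {set V * V}) :
  disjoint_paths A -> {in A &, injective fst} /\ {in A &, injective snd}.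
Proof.
case=> P [uP AP].
have Aflat a : a \in A -> infix [:: a.1; a.2] (flatten P).
  case: a => u v /AP[p /splitPr[P1 P2] uvp]; apply: infix_trans uvp _.
  by apply/infixP; exists (flatten P1), (flatten P2); rewrite flatten_cat.
split=> -[u v] [u' v'] /Aflat/= uv /Aflat/= uv' /= eq_uv.
  have [-> _] := infix2_nth u uP uv; have [-> _] := infix2_nth u uP uv'.
  by rewrite eq_uv.
have [_ ->] := infix2_nth u uP uv; have [_ ->] := infix2_nth u uP uv'.
by rewrite eq_uv.
Qed.

(** * Complete forcing on growing graphs, and the scan for a fort *)

Lemma White_set0_setU (V : finType) (e : rel V) (S U T : {set V}) :
  White e S U = set0 -> White e (S :|: T) (U :|: T) = set0.
Proof.
move/eqP; rewrite setD_eq0 => sUB; apply/eqP; rewrite setD_eq0.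
suff sub n : iter n (zf_round e U) S :|: T
    \subset iter n (zf_round e (U :|: T)) (S :|: T).
  by apply: subset_trans (sub _); apply: setSU.
elim: n => //= n; set B := iter n _ S; set C := iter n _ _ => sBTC.
have [sBC sTC] : B \subset C /\ T \subset C.
  by apply/andP; rewrite -subUset.
rewrite subUset (subset_trans sTC (subsetUl _ _)) andbT.
apply/subsetP=> x; rewrite !inE; have [//|xC] := boolP (x \in C).
case/orP=> [xB|/existsP[u /and5P[uU uB]]]; first by rewrite (subsetP sBC) in xC.
rewrite inE => /andP[_ xU] eux /eqP Nu; apply/existsP; exists u.
rewrite /can_force !inE uU (subsetP sBC) // xU xC eux /=.
rewrite eqEsubset sub1set !inE xC xU eux orbT /= andbT.
(* Vertices of [T] start blue, so a white neighbour of [u] lies in [U] and is also white in the run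
   on [U]. *)
apply/subsetP=> y; rewrite -Nu !inE => /and3P[yC /orP[yU|yT] ->].
  by rewrite yU (contraNN _ yC) //; apply: (subsetP sBC).
by rewrite (subsetP sTC) in yC.
Qed.

Lemma in_bags (V : finType) (X : nat -> {set V}) i j x :
  reflect (exists2 s, i <= s <= j & x \in X s) (x \in bags X i j).
Proof.
rewrite /bags; apply: (iffP idP) => [|[s sij xs]]; last first.
  by rewrite (bigD1_seq s) /= ?mem_index_iota ?iota_uniq // inE xs.
rewrite big_seq; elim/big_ind: _ => [|B C IHB IHC|s].
- by rewrite inE.
- by case/setUP.
by rewrite mem_index_iota ltnS => sij xs; exists s.
Qed.

Lemma bags_recr (V : finType) (X : nat -> {set V}) t z :
  t <= z -> bags X t z.+1 = bags X t z :|: X z.+1.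
Proof. by move=> tz; rewrite /bags big_nat_recr // leqW. Qed.

(** The scan only moves past indices with no white vertex; the last hypothesis says this of the
    starting index, so it holds of the predecessor [y] of the index found. *)
Lemma scan_found (V : finType) (e : rel V) (X : nat -> {set V}) n t z z' W :
  scan e X n t z = (z', W) -> W != set0 ->
  White e (X t :|: X z) (bags X t z) = set0 ->
  exists y, [/\ z' = y.+1, z <= y < n + z,
    White e (X t :|: X y) (bags X t y) = set0
    & W = White e (X t :|: X y.+1) (bags X t y.+1)].
Proof.
elim: n z => [|n IH] z /=; first by case=> _ <-; rewrite eqxx.
case: ifPn => [/eqP W0 /IH{}IH Wn0 _|_ [<- <-] _ z0]; last first.
  by exists z; rewrite leqnn addSn ltnS leq_addl.
have [y [-> /andP[zy yn] ? ?]] := IH Wn0 W0.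
by exists y; rewrite (ltnW zy) addSnnS.
Qed.

(** * Bags of a nice path decomposition *)

Section Decomposition.

Variables (V : finType) (e : rel V) (k : nat) (X : nat -> {set V}).
Hypothesis X_nice : nice_path_decomposition e k X.

Lemma card_bag_le i : i <= k.+1 -> #|X i| <= pd_width k X + 1.
Proof.
case: X_nice => _ _ [X0 Xk _] _ _ ik.
have [->|i0] := posnP i; first by rewrite X0 cards0.
move: ik; rewrite leq_eqVlt => /predU1P[->|ik]; first by rewrite Xk cards0.
rewrite addnC -leq_subLR /pd_width.
by apply: (bigmaxn_sup_seq i) => //; rewrite mem_index_iota i0.
Qed.

(** Condition (D2) applied across index [t]; if the two bags do not straddle [t], both indices equal
    [t]. *)
Lemma bags_separated t z x : t <= z -> z <= k.+1 ->
  x \in bags X 0 t -> x \in bags X t z -> x \in X t.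
Proof.
case: X_nice => _ conv _ _ _ tz zk /in_bags[i /= it xi] /in_bags[j /andP[tj jz] xj].
have [ij|ji] := ltnP i j.
  by apply: (conv x i j) => //; [apply: leq_trans jz zk|rewrite it].
suff -> : t = i by [].
by apply/eqP; rewrite eqn_leq it (leq_trans tj).
Qed.

(** Were a vertex added, the run at [z.+1] would be the complete run at [z] with [X z.+1] joined to
    both graph and blue set. *)
Lemma found_fort_deletes t z : t <= z <= k ->
  White e (X t :|: X z) (bags X t z) = set0 ->
  White e (X t :|: X z.+1) (bags X t z.+1) != set0 ->
  X z.+1 \subset X z.
Proof.
case: X_nice => _ _ _ step _ /andP[tz zk] W0 Wn0.
have [v [[vX Xz]|[vX ->]]] := step z zk; last exact: subsetDl.
case/eqP: Wn0; move/White_set0_setU: W0 => /(_ (X z.+1)).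
rewrite -setUA (setUidPr (_ : X z \subset X z.+1)); last by rewrite Xz subsetUr.
by rewrite -bags_recr.
Qed.

(** * The invariant of the outer loop *)

Variable fas : {set V} -> {set V} -> {set V * V}.
Hypothesis fas_spec : FAS_spec e fas.

(** Heads avoid [X t] so that, once reversed, old arcs leave no vertex shared with the next stretch
    of bags. *)
Definition inner_arcs t (A : {set V * V}) : Prop :=
  forall a, a \in A ->
    [&& a.1 \in bags X 0 t, a.2 \in bags X 0 t & a.2 \notin X t].

(** Path disjointness is kept as in- and out-degree at most one. The bound concerns the sources of
    the current arcs, since each pass recomputes its set from them. *)
Definition pass_invariant (st : state V) : Prop :=
  let: State t _ A F := st in
  [/\ t <= k.+1, inner_arcs t A,
      {in A &, injective fst} /\ {in A &, injective snd},
      forall W, W \in F -> W \subset bags X 0 t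
    & #|Sources A (bags X 0 t)| <= (pd_width k X + 1) * #|F|].

Lemma card_Sources_rev t (A : {set V * V}) : inner_arcs t A ->
  {in A &, injective fst} -> {in A &, injective snd} ->
  #|Sources (arc_rev A) (bags X 0 t)| = #|Sources A (bags X 0 t)|.
Proof.
move=> At injf injs; apply/eqP; rewrite -(eqn_add2r #|A|).
rewrite [X in _ == X]card_Sources // => [|a /At/and3P[-> ->] //].
have <- : #|arc_rev A| = #|A|.
  by rewrite card_imset // => -[a b] [c d] [-> ->].
rewrite card_Sources // => [[u v]|[u v] [u' v']].
  by rewrite in_arc_rev => /At/and3P[/= -> ->].
by rewrite !in_arc_rev => uv uv' /= eq_v; case: (injf _ _ uv uv' eq_v) => -> ->.
Qed.

Lemma pass_invariant_next t S A F st' :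
  pass_invariant (State t S A F) ->
  zfs_pass e k X fas (State t S A F) = (st', true) -> pass_invariant st'.
Proof.
case=> tk At [injf injs] Ft cardS; rewrite /zfs_pass.
case scanE: scan => [z W]; case: ifP => // Wn0 [<-] {st'}.
have Wtt : White e (X t :|: X t) (bags X t t) = set0.
  apply/eqP; rewrite setD_eq0 /bags big_nat1 setUid.
  exact: (iter_zf_round_inflate e _ _ (leq0n _)).
have [y [zE /andP[ty yk] Wy WE]] := scan_found scanE Wn0 Wtt.
rewrite {z}zE in scanE *; rewrite subnK // ltnS in yk => /=.
have Xy1 : X y.+1 \subset X y.
  by apply: (found_fort_deletes (t := t)); rewrite ?ty // -WE.
have t0y : bags X 0 t \subset bags X 0 y.+1.
  apply/subsetP=> x /in_bags[s st xs]; apply/in_bags; exists s => //.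
  by apply: leq_trans st (leqW ty).
have ty0 : bags X t y.+1 \subset bags X 0 y.+1.
  by apply/subsetP=> x /in_bags[s /andP[_ sy] xs]; apply/in_bags; exists s.
have cover x : x \in bags X 0 y.+1 -> x \notin bags X 0 t -> x \in bags X t y.+1.
  case/in_bags=> s /= sy xs xt; apply/in_bags; exists s => //.
  rewrite sy andbT leqNgt; apply: contra xt => st.
  by apply/in_bags; exists s => //=; apply: ltnW.
have sep x : x \in bags X 0 t -> x \in bags X t y.+1 -> x \in X t.
  by apply: bags_separated => //; apply: leqW.
have Xsub : X t :|: X y \subset bags X t y.+1.
  apply/subsetP=> x /setUP[] xX; apply/in_bags; [exists t|exists y] => //.
    by rewrite leqnn leqW.
  by rewrite ty leqnSn.
(* The arc set is requested on the bags up to [y.+1]; as [X y.+1] lies in [X y], these have the same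
   union as the bags up to [y], where forcing was complete. *)
have Wy' : White e (X t :|: X y) (bags X t y.+1) = set0.
  rewrite bags_recr // [bags X t y :|: _](setUidPl _) //.
  apply: subset_trans Xy1 _.
  by apply/subsetP=> x xX; apply/in_bags; exists y; rewrite ?ty ?leqnn.
have [[[Barc _] /disjoint_paths_inj[injfB injsB] _] srcB] := fas_spec Xsub Wy'.
set B := fas _ _ in Barc injfB injsB srcB *.
have B_in u v : (u, v) \in B -> (u \in bags X t y.+1) && (v \in bags X t y.+1).
  by case/Barc/and3P=> -> ->.
(* A head in [bags X 0 t] would lie in [X t] by separation, hence be a source of [B]. *)
have B_head u v : (u, v) \in B -> v \notin bags X 0 t.
  move=> uv; have /andP[uU vU] := B_in _ _ uv; apply: contraL uv => vt.
  have: v \in Sources B (bags X t y.+1) by rewrite srcB inE sep.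
  by rewrite inE => /andP[_ /forall_inP]; apply.
set A' := [set a in _ | _].
have inA' u v : ((u, v) \in A') =
    (((v, u) \in A) || ((u, v) \in B)) && (v \notin X y.+1).
  by rewrite !inE in_arc_rev.
have inj1 : {in A' &, injective fst}.
  have mixed u v v' : (v, u) \in A -> (u, v') \in B -> False.
    move=> /At/and3P[/= _ ut uX] /B_in/andP[uz _].
    by rewrite sep in uX.
  move=> [u v] [u' v']; rewrite !inA'.
  move=> /andP[+ _] /andP[+ _] /= eq_u; rewrite -{u'}eq_u.
  case/orP=> uv /orP[] uv'.
  - by case: (injs _ _ uv uv' erefl) => ->.
  - by case: (mixed _ _ _ uv uv').
  - by case: (mixed _ _ _ uv' uv).
  - exact: injfB.
have inj2 : {in A' &, injective snd}.
  have mixed u u' v : (v, u) \in A -> (u', v) \in B -> False.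
    by move=> /At/and3P[/= vt _ _] /B_head/negP.
  move=> [u v] [u' v']; rewrite !inA'.
  move=> /andP[+ _] /andP[+ _] /= eq_v; rewrite -{v'}eq_v.
  case/orP=> uv /orP[] uv'.
  - by case: (injf _ _ uv uv' erefl) => ->.
  - by case: (mixed _ _ _ uv uv').
  - by case: (mixed _ _ _ uv' uv).
  - exact: injsB.
have W_sub : W \subset bags X t y.+1 by rewrite WE subsetDl.
(* Earlier forts lie in [bags X 0 t], so a repeated one would have its vertices in [X t], which is
   blue from the start. *)
have W_new : W \notin F.
  apply/negP=> /Ft Wt; have /set0Pn[x xW] := Wn0.
  have xt : x \in X t by apply: sep; [apply: (subsetP Wt)|apply: (subsetP W_sub)].
  move: xW; rewrite WE inE => /andP[/negP xB _]; apply: xB.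
  apply: (subsetP (iter_zf_round_inflate e _ _ (leq0n _))).
  by rewrite inE xt.
split=> //.
- case=> u v /=; rewrite inA' => /andP[/orP[/At/and3P[/= vt ut _]|uv] ->].
    by rewrite !(subsetP t0y).
  by have /andP[uz vz] := B_in _ _ uv; rewrite !(subsetP ty0).
- move=> W' /setU1P[->|/Ft W't]; last exact: subset_trans t0y.
  exact: subset_trans ty0.
rewrite cardsU1 W_new mulnDr muln1.
(* A vertex in neither set receives a reversed old arc if seen by [t], otherwise an arc of [B]; it
   lies outside [X y.+1], so that arc is kept. *)
apply: leq_trans (_ : #|X y :|: Sources (arc_rev A) (bags X 0 t)| <= _).
  apply/subset_leq_card/subsetP=> x; rewrite [in X in X -> _]inE.
  case/andP=> xz /forall_inP noA'; apply: contraT; rewrite inE negb_or.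
  case/andP=> xy nsrc; have xy1 : x \notin X y.+1 by apply: contra xy; apply/subsetP.
  have [xt|xt] := boolP (x \in bags X 0 t).
    move: nsrc; rewrite inE xt /= => /forall_inPn[u ut]; rewrite negbK in_arc_rev.
    move=> xu; have := noA' u (subsetP t0y _ ut).
    by rewrite inA' xu xy1.
  have xU := cover _ xz xt.
  have: x \notin Sources B (bags X t y.+1).
    rewrite srcB inE negb_or xy andbT; apply: contra xt => xt.
    by apply/in_bags; exists t => //=.
  rewrite inE xU /= => /forall_inPn[u uU]; rewrite negbK => ux.
  by have := noA' u (subsetP ty0 _ uU); rewrite inA' ux orbT xy1.
apply: leq_trans (leq_card_setU _ _) _; rewrite card_Sources_rev //.
by apply: leq_add => //; apply: card_bag_le; apply: leqW.
Qed.

(** The last pass keeps [F] and returns the sources of the reversed arcs, which are as many as those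
    bounded by the invariant. *)
Lemma run_card_le st st' : zfs_run e k X fas st st' -> pass_invariant st ->
  #|st_S st'| <= (pd_width k X + 1) * #|st_F st'|.
Proof.
elim=> {st st'} [[t S A F] st'|[t S A F] st st' pass _ IH inv]; last first.
  exact: IH (pass_invariant_next inv pass).
rewrite /zfs_pass; case: scan => z W; case: ifP => // _ [<-] [_ At [injf injs] _ /=].
by rewrite card_Sources_rev.
Qed.

End Decomposition.

Theorem theorem4p10 (V : finType) (e : rel V)
    (e_sym : symmetric e) (e_irr : irreflexive e)
    (fas : {set V} -> {set V} -> {set V * V}) (fas_spec : FAS_spec e fas)
    (k w : nat) (X : nat -> {set V})
    (X_nice : nice_path_decomposition e k X) (X_width : pd_width k X = w)
    (S : {set V}) (F : {set {set V}})
    (SF_returned : zfs_returns e k X fas S F) :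
  #|S| <= (w + 1) * #|F|.
Proof.
rewrite -X_width; case: SF_returned => st run [<- <-].
apply: run_card_le run _ => //; split=> //.
- by move=> a; rewrite inE.
- by split=> a; rewrite inE.
- by move=> W; rewrite inE.
(* Initially the only bag seen is [X 0], which is empty and so has no sources. *)
have [_ _ [X0 _ _] _ _] := X_nice.
rewrite cards0 muln0 /bags big_nat1 X0 leqn0 cards_eq0.
by apply/eqP/setP=> x; rewrite !inE.
Qed.
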